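(* Let $A$ be an integral domain with quotient field $K$ and let $B$ be an overring of $A$ (i.e. a ring with $A\subseteq B\subseteq K$). Let $\sigma:\mathrm{SStar}(B)\to\mathrm{SStar}(A)$ be the map sending $\star$ to the semistar operation $\sigma(\star)$ on $A$ defined by $F^{\sigma(\star)}:=(FB)^\star\cap K$ (which equals $(FB)^\star$ here) for every nonzero $A$-submodule $F$ of $K$. Then $\sigma$ is a topological embedding (for the Zariski topologies).
   Context: For an integral domain $R$ with quotient field $Q$: $\overline{\mathbf F}(R)$ is the set of all nonzero $R$-submodules of $Q$. A semistar operation on $R$ is a map $\star:\overline{\mathbf F}(R)\to\overline{\mathbf F}(R)$, $F\mapsto F^\star$, such that for all nonzero $k\in Q$ and all $F,G\in\overline{\mathbf F}(R)$: $(kF)^\star=kF^\star$; $F\subseteq G$ implies $F^\star\subseteq G^\star$; $F\subseteq F^\star$; $(F^\star)^\star=F^\star$. $\mathrm{SStar}(R)$ is the set of all semistar operations on $R$, endowed with the Zariski topology, which has as a subbasis of open sets the sets $V_F^{(R)}:=\{\star\in\mathrm{SStar}(R):1\in F^\star\}$, for $F\in\overline{\mathbf F}(R)$. A topological embedding is a map that is a homeomorphism onto its image endowed with the subspace topology. *)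

(* Defs.v *)
From HB Require Import structures.
From mathcomp Require Import all_boot all_order all_algebra.
From mathcomp Require Import all_classical topology.

Set Implicit Arguments.
Unset Strict Implicit.
Unset Printing Implicit Defensive.

Import GRing.Theory.
Local Open Scope classical_set_scope.
Local Open Scope ring_scope.

(* An integral domain with quotient field K is given as a subring R of K such
   that every element of K is a quotient of elements of R, so that the
   submodules of its quotient field are subsets of K. *)
Definition is_quotient_field (K : fieldType) (R : subringClosed K) : Prop :=
  forall x : K, exists a b : K, [/\ a \in R, b \in R, b != 0 & x = a / b].

(* An overring has the same quotient field, so its submodules live in K too. *)
Lemma is_quotient_field_overring (K : fieldType) (R S : subringClosed K) :
  {subset R <= S} -> is_quotient_field R -> is_quotient_field S.
Proof.
move=> RS qR x; have [a [b [aR bR b0 ->]]] := qR x.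
by exists a, b; split => //; exact: RS.
Qed.

Record Fbar (K : fieldType) (R : subringClosed K) := MkFbar {
  fbar_set :> set K ;
  fbar0 : fbar_set 0 ;
  fbarD : forall x y, fbar_set x -> fbar_set y -> fbar_set (x + y) ;
  fbarZ : forall a x, a \in R -> fbar_set x -> fbar_set (a * x) ;
  fbar_neq0 : exists2 x, fbar_set x & x != 0
}.

Section Fbar.
Context (K : fieldType).
Implicit Types R A B : subringClosed K.

Lemma fbar_eq R (F G : Fbar R) : fbar_set F = fbar_set G -> F = G.
Proof.
case: F G => [F F0 FD FZ Fn] [G G0 GD GZ Gn] /= FG; subst G.
by congr MkFbar; exact: Prop_irrelevance.
Qed.

Lemma fbarT_neq0 : exists2 x : K, [set: K] x & x != 0.
Proof. by exists 1; rewrite ?oner_neq0. Qed.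

Definition fbarT R : Fbar R :=
  @MkFbar K R setT I (fun _ _ _ _ => I) (fun _ _ _ _ => I) fbarT_neq0.

HB.instance Definition _ R := gen_eqMixin (Fbar R).
HB.instance Definition _ R := gen_choiceMixin (Fbar R).
HB.instance Definition _ R := isPointed.Build (Fbar R) (fbarT R).

Section Scale.
Context R (k : K) (k0 : k != 0) (F : Fbar R).

Let S : set K := [set k * x | x in fbar_set F].

Fact scale0 : S 0.
Proof. by exists 0; [exact: fbar0 | rewrite mulr0]. Qed.

Fact scaleD x y : S x -> S y -> S (x + y).
Proof.
by move=> [u Fu <-] [v Fv <-]; exists (u + v); [exact: fbarD | rewrite mulrDr].
Qed.

Fact scaleZ a x : a \in R -> S x -> S (a * x).
Proof.
by move=> aR [u Fu <-]; exists (a * u); [exact: fbarZ | rewrite mulrCA].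
Qed.

Fact scale_neq0 : exists2 x, S x & x != 0.
Proof.
by have [x Fx x0] := fbar_neq0 F; exists (k * x); [exists x | rewrite mulf_neq0].
Qed.

Definition fbar_scale : Fbar R := MkFbar scale0 scaleD scaleZ scale_neq0.

End Scale.

Section Extend.
Context A B (F : Fbar A).

Let FB : set K := [set x | exists n (f b : 'I_n -> K),
  [/\ forall i, fbar_set F (f i), forall i, b i \in B & x = \sum_(i < n) f i * b i]].

Fact extend0 : FB 0.
Proof.
exists 0%N, (fun _ => 0), (fun _ => 0); split; [by case|by case|].
by rewrite big_ord0.
Qed.

Fact extendD x y : FB x -> FB y -> FB (x + y).
Proof.
move=> [n [f [b [Ff Bb ->]]]] [m [g [c [Fg Bc ->]]]].
pose glue (u : 'I_n -> K) (v : 'I_m -> K) i :=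
  match fintype.split i with inl j => u j | inr j => v j end.
exists (n + m)%N, (glue f g), (glue b c); split.
- by move=> i; rewrite /glue; case: (fintype.split i).
- by move=> i; rewrite /glue; case: (fintype.split i).
- rewrite big_split_ord /glue /=; congr (_ + _); apply: eq_bigr => i _.
  + by rewrite (unsplitK (inl i)).
  + by rewrite (unsplitK (inr i)).
Qed.

Fact extendZ a x : a \in B -> FB x -> FB (a * x).
Proof.
move=> aB [n [f [b [Ff Bb ->]]]].
exists n, f, (fun i => a * b i); split => // [i|]; first exact: rpredM.
by rewrite mulr_sumr; apply: eq_bigr => i _; rewrite mulrCA.
Qed.

Fact extend_sub x : fbar_set F x -> FB x.
Proof.
move=> Fx; exists 1%N, (fun _ => x), (fun _ => 1); split => // [_|].
  exact: rpred1.
by rewrite big_ord1 mulr1.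
Qed.

Fact extend_neq0 : exists2 x, FB x & x != 0.
Proof. by have [x Fx x0] := fbar_neq0 F; exists x => //; exact: extend_sub. Qed.

(* The B-submodule FB of K generated by F. *)
Definition fbar_extend : Fbar B := MkFbar extend0 extendD extendZ extend_neq0.

End Extend.

Definition fbar_restrict A B (AB : {subset A <= B}) (G : Fbar B) : Fbar A :=
  @MkFbar K A G (@fbar0 _ _ G) (@fbarD _ _ G)
    (fun a x aA => @fbarZ _ _ G a x (AB a aA)) (fbar_neq0 G).

End Fbar.

Record SStar (K : fieldType) (R : subringClosed K) := MkSStar {
  sstar_fun :> Fbar R -> Fbar R ;
  sstar_scale : forall (k : K) (k0 : k != 0) (F : Fbar R),
    sstar_fun (fbar_scale k0 F) = fbar_scale k0 (sstar_fun F) ;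
  sstar_mono : forall F G : Fbar R, F `<=` G -> sstar_fun F `<=` sstar_fun G ;
  sstar_ext : forall F : Fbar R, F `<=` sstar_fun F ;
  sstar_idem : forall F : Fbar R, sstar_fun (sstar_fun F) = sstar_fun F
}.

Definition zariski_subbase (K : fieldType) (R : subringClosed K) (F : Fbar R) :
  set (SStar R) := [set star | fbar_set (star F) 1].

HB.instance Definition _ (K : fieldType) (R : subringClosed K) :=
  gen_eqMixin (SStar R).
HB.instance Definition _ (K : fieldType) (R : subringClosed K) :=
  gen_choiceMixin (SStar R).
HB.instance Definition _ (K : fieldType) (R : subringClosed K) :=
  isSubBaseTopological.Build (SStar R) [set: Fbar R]
    (@zariski_subbase K R).

Section Sigma.
Context (K : fieldType) (A B : subringClosed K) (AB : {subset A <= B}).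
Context (star : SStar B).

(* The intersection with K is omitted: all modules here are subsets of K. *)
Let op (F : Fbar A) : Fbar A := fbar_restrict AB (star (fbar_extend B F)).

Fact sigma_scale (k : K) (k0 : k != 0) (F : Fbar A) :
  op (fbar_scale k0 F) = fbar_scale k0 (op F).
Proof.
apply: fbar_eq => /=.
have -> : fbar_extend B (fbar_scale k0 F) = fbar_scale k0 (fbar_extend B F).
  apply: fbar_eq; apply/seteqP; split => x /=.
    move=> [n [f [b [Ff Bb ->]]]].
    exists (\sum_(i < n) (k^-1 * f i) * b i); last first.
      rewrite mulr_sumr; apply: eq_bigr => i _.
      by rewrite !mulrA mulfV // mul1r.
    exists n, (fun i => k^-1 * f i), b; split=> // i.
    by have [u Fu <-] := Ff i; rewrite mulKf.
  move=> [_ [n [f [b [Ff Bb ->]]]] <-].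
  exists n, (fun i => k * f i), b; split => // [i|]; first by exists (f i).
  by rewrite mulr_sumr; apply: eq_bigr => i _; rewrite mulrA.
by rewrite sstar_scale.
Qed.

Fact sigma_mono (F G : Fbar A) : F `<=` G -> op F `<=` op G.
Proof.
move=> FG; apply: sstar_mono => x /= [n [f [b [Ff Bb ->]]]].
by exists n, f, b; split => // i; exact: FG.
Qed.

Fact sigma_ext (F : Fbar A) : F `<=` op F.
Proof. by move=> x Fx; apply: sstar_ext; exact: extend_sub. Qed.

Fact sigma_idem (F : Fbar A) : op (op F) = op F.
Proof.
apply: fbar_eq => /=; set G := star (fbar_extend B F).
suff -> : fbar_extend B (op F) = G by rewrite sstar_idem.
apply: fbar_eq; apply/seteqP; split => x; last exact: (@extend_sub K A B (op F)).
move=> /= [n [f [b [Ff Bb ->]]]].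
elim/big_ind: _ => [|u v|i _]; [exact: fbar0|exact: fbarD|].
by rewrite mulrC; apply: fbarZ; [exact: Bb|exact: Ff].
Qed.

Definition sigma : SStar A := MkSStar sigma_scale sigma_mono sigma_ext sigma_idem.

End Sigma.

Definition homeomorphism (X Y : topologicalType) (f : X -> Y) : Prop :=
  exists g : Y -> X, [/\ cancel f g, cancel g f, continuous f & continuous g].

Definition to_range (X Y : Type) (f : X -> Y) (x : X) : range f :=
  exist _ (f x) (mem_set (imageT f x)).

(* The type [range f] carries the library topology of [set_type], which is the
   subspace topology. *)
Definition topological_embedding (X Y : topologicalType) (f : X -> Y) : Prop :=
  @homeomorphism X (range f) (to_range f).

(* Main.v *)
Require Import Defs.
From mathcomp Require Import all_boot all_order all_algebra.
From mathcomp Require Import all_classical topology.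

(** Every [B]-submodule [G] of [K] is also an [A]-submodule, and extending it
    back to [B] changes nothing: [GB = G]. Hence [sigma] of [star], applied to
    [G] seen over [A], returns the value of [star] at [G], and [star] can be
    recovered from its image; this gives injectivity. The same identity says
    that the subbasic open set of [G] over [B] is the preimage under [sigma] of
    the subbasic open set of [G] over [A], while by the definition of [sigma]
    the preimage of the subbasic open set of an [A]-submodule [F] is the
    subbasic open set of [FB]. So [sigma] is continuous, and the topology of its
    domain is the one induced by its codomain
    ([preimage_zariski_subbase_extend], [preimage_zariski_subbase_restrict]). *)

Set Implicit Arguments.
Unset Strict Implicit.
Unset Printing Implicit Defensive.

Import GRing.Theory.
Local Open Scope classical_set_scope.
Local Open Scope ring_scope.

Section ZariskiTopology.
Context (K : fieldType).
Implicit Types R : subringClosed K.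

Lemma sstar_eq R (star1 star2 : SStar R) :
  (forall F, star1 F = star2 F) -> star1 = star2.
Proof.
case: star1 star2 => [s1 a1 b1 c1 d1] [s2 a2 b2 c2 d2] /= /funext s12.
by subst s2; congr MkSStar; exact: Prop_irrelevance.
Qed.

Lemma open_zariski_subbase R (F : Fbar R) : open (zariski_subbase F).
Proof.
exists [set zariski_subbase F]; last by rewrite bigcup_set1.
by move=> _ ->; exact: finI_from1.
Qed.

Lemma continuous_zariski (X : topologicalType) R (f : X -> SStar R) :
  (forall F : Fbar R, open (f @^-1` zariski_subbase F)) -> continuous f.
Proof.
move=> openF; apply/continuousP => _ [D' D'finI <-].
rewrite preimage_bigcup; apply: bigcup_open => V /D'finI [E _ <-].
rewrite bigcap_fset.
apply: (big_ind (fun U => open (f @^-1` U))) => [|U W|F _].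
- exact: openT.
- exact: openI.
- exact: openF.
Qed.

(** The set-theoretic inverse on the range is continuous as soon as the
    subbasic open sets of the domain are induced from the codomain, since
    preimages commute with unions and intersections. *)
Lemma zariski_embedding R (Y : topologicalType) (f : SStar R -> Y) :
  injective f -> continuous f ->
  (forall F : Fbar R, exists2 V, open V & f @^-1` V = zariski_subbase F) ->
  topological_embedding f.
Proof.
move=> injf contf inducedF.
pose g (y : range f) : SStar R := projT1 (cid2 (set_mem (valP y))).
have gK y : f (g y) = set_val y.
  by rewrite /g; case: cid2.
exists g; split.
- by move=> x; apply: injf; rewrite gK.
- by move=> y; apply: val_inj; exact: gK.
- exact: continuous_comp_initial.
- apply: continuous_zariski => F; have [V oV <-] := inducedF F.
  exists V => //; apply/seteqP; split=> y /=; by rewrite gK.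
Qed.

End ZariskiTopology.

Section Sigma.
Context (K : fieldType) (A B : subringClosed K) (AB : {subset A <= B}).

(** A sum of products of elements of [G] and [B] already lies in [G], because
    [G] is a [B]-module. *)
Lemma extend_restrict (G : Fbar B) : fbar_extend B (fbar_restrict AB G) = G.
Proof.
apply: fbar_eq; apply/seteqP; split=> x; last first.
  exact: (@extend_sub K A B (fbar_restrict AB G)).
move=> [n [f [b [Gf Bb ->]]]].
elim/big_ind: _ => [|u v|i _]; [exact: fbar0|exact: fbarD|].
by rewrite mulrC; apply: fbarZ; [exact: Bb|exact: Gf].
Qed.

Lemma sigma_restrict (star : SStar B) (G : Fbar B) :
  sigma AB star (fbar_restrict AB G) = fbar_restrict AB (star G).
Proof. by rewrite /= extend_restrict. Qed.

Lemma sigma_inj : injective (sigma AB).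
Proof.
move=> star1 star2 s12; apply: sstar_eq => G; apply: fbar_eq.
have := congr1 (fun s : SStar A => fbar_set (s (fbar_restrict AB G))) s12.
by rewrite !sigma_restrict.
Qed.

Lemma preimage_zariski_subbase_extend (F : Fbar A) :
  sigma AB @^-1` zariski_subbase F = zariski_subbase (fbar_extend B F).
Proof. by []. Qed.

Lemma preimage_zariski_subbase_restrict (G : Fbar B) :
  sigma AB @^-1` zariski_subbase (fbar_restrict AB G) = zariski_subbase G.
Proof. by rewrite preimage_zariski_subbase_extend extend_restrict. Qed.

End Sigma.

Theorem proposition3p5 (K : fieldType) (A B : subringClosed K)
    (hK : is_quotient_field A) (AB : {subset A <= B}) :
  topological_embedding (fun star : SStar B => sigma AB star).
Proof.
apply: zariski_embedding.
- exact: sigma_inj.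
- apply: continuous_zariski => F.
  rewrite preimage_zariski_subbase_extend; exact: open_zariski_subbase.
- move=> G; exists (zariski_subbase (fbar_restrict AB G)).
    exact: open_zariski_subbase.
  exact: preimage_zariski_subbase_restrict.
Qed.
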